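(* Let $G$ be a non-cyclic finitely generated group with infinite abelianization. Then the generic-case complexity of the conjugacy problem for $G$ is linear time.
   Context: Conjugacy problem. If $A$ is a finite generating set of a group $G$ (i.e. a finite set with a map $\pi:A\to G$ whose image generates $G$), let $X=A\cup A^{-1}$ ($A^{-1}$ the set of formal inverses), let $X^*$ be the set of all words over $X$, and extend $\pi$ to $X^*\to G$. The conjugacy problem with respect to $A$ is the set $CP(G,A)=\{(u,v)\in X^*\times X^* : \pi(u),\pi(v)\text{ are conjugate in }G\}$. Genericity. The length of a pair $(w_1,w_2)\in X^*\times X^*$ is $|w_1|+|w_2|$. For $S\subseteq X^*\times X^*$ let $B_n$ be the set of all pairs of length at most $n$ and $\rho_n(S)=|S\cap B_n|/|B_n|$. $S$ is generic if $\lim_{n\to\infty}\rho_n(S)=1$. Generic-case complexity. Let $\mathcal{D}\subseteq X^*\times X^*$. A partial algorithm $\Omega$ (on a multi-tape Turing machine) is correct for $\mathcal{D}$ if whenever it reaches a decision on whether an input belongs to $\mathcal{D}$, that decision is correct. A correct partial algorithm $\Omega$ solves $\mathcal{D}$ with generic-case complexity linear time if there is a generic set $S\subseteq X^*\times X^*$ such that on every input from $S$ the algorithm terminates with a decision in a number of steps bounded by a fixed linear function of the length of the input. The generic-case complexity of the conjugacy problem for $G$ is linear time if for every finite generating set $A$ of $G$ there is a correct partial algorithm solving $CP(G,A)$ with generic-case complexity linear time. *)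

(* Defs.v *)
From HB Require Import structures.
From mathcomp Require Import all_boot all_order all_algebra finmap.
From mathcomp Require Import all_classical all_reals topology normedtype.
Set Implicit Arguments.
Unset Strict Implicit.
Unset Printing Implicit Defensive.
Import Order.TTheory GRing.Theory Num.Theory.
Import numFieldNormedType.Exports.
Local Open Scope classical_set_scope.

Section Groups.
Local Open Scope group_scope.

Definition subgroup (G : groupType) (H : set G) : Prop :=
  [/\ H 1, forall x y, H x -> H y -> H (x * y) & forall x, H x -> H x^-1].

Definition subgroup_generated (G : groupType) (S : set G) : set G :=
  smallest (@subgroup G) S.

Definition cyclic_group (G : groupType) : Prop :=
  exists g : G, subgroup_generated [set g] = [set: G].

(* A generating set is an indexed family; it need not be injective. *)
Definition generates (G : groupType) (A : finType) (pi : A -> G) : Prop :=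
  subgroup_generated (range pi) = [set: G].

Definition finitely_generated (G : groupType) : Prop :=
  exists (A : finType) (pi : A -> G), generates pi.

Definition derived_subgroup (G : groupType) : set G :=
  subgroup_generated [set z | exists x y : G, z = [~ x, y]].

Definition left_coset (G : groupType) (H : set G) (g : G) : set G :=
  [set g * h | h in H].

(* The underlying set of G / [G, G], as the set of cosets of [G, G]. *)
Definition abelianization (G : groupType) : set (set G) :=
  range (left_coset (@derived_subgroup G)).

Definition conjugate_in (G : groupType) (x y : G) : Prop :=
  exists g : G, x ^ g = y.

(* The alphabet X is A + A: [inl a] is the generator a and [inr a] is its
   formal inverse. *)
Definition letter_value (G : groupType) (A : finType) (pi : A -> G)
    (x : A + A) : G :=
  match x with inl a => pi a | inr a => (pi a)^-1 end.

Definition word_value (G : groupType) (A : finType) (pi : A -> G)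
    (w : seq (A + A)) : G :=
  \prod_(x <- w) letter_value pi x.

Definition conjugacy_problem (G : groupType) (A : finType) (pi : A -> G) :
    set (seq (A + A) * seq (A + A)) :=
  [set p | conjugate_in (word_value pi p.1) (word_value pi p.2)].

End Groups.

Arguments derived_subgroup G : clear implicits.
Arguments abelianization G : clear implicits.

Section Genericity.

Definition pair_length (X : Type) (p : seq X * seq X) : nat :=
  (size p.1 + size p.2)%N.

Definition ball (X : Type) (n : nat) : set (seq X * seq X) :=
  [set p | (pair_length p <= n)%N].

(* [fset_set] is the empty set on infinite sets; balls are finite. *)
Lemma finite_ball (X : finType) (n : nat) : finite_set (@ball X n).
Proof.
pose f (q : n.-bseq X * n.-bseq X) : seq X * seq X :=
  (bseqval q.1, bseqval q.2).
apply: (@sub_finite_set _ _ (range f)); last exact/finite_image/finite_finset.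
move=> [u v]; rewrite /ball /pair_length /= => len_uv.
have len_u : (size u <= n)%N by apply: leq_trans len_uv; rewrite leq_addr.
have len_v : (size v <= n)%N by apply: leq_trans len_uv; rewrite leq_addl.
by exists (Bseq len_u, Bseq len_v).
Qed.

Local Open Scope ring_scope.

Definition density (R : realType) (X : finType) (S : set (seq X * seq X))
    (n : nat) : R :=
  #|` fset_set (S `&` @ball X n)|%:R / #|` fset_set (@ball X n)|%:R.

Definition generic (R : realType) (X : finType) (S : set (seq X * seq X)) :
    Prop :=
  density R S n @[n --> \oo] --> (1 : R).

End Genericity.

Section TuringMachines.
Local Open Scope ring_scope.

Inductive move := MoveLeft | Stay | MoveRight.

Definition move_offset (m : move) : int :=
  match m with MoveLeft => -1 | Stay => 0 | MoveRight => 1 end.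

(* A deterministic Turing machine with [tm_extra.+1] two-way infinite tapes;
   the input is on tape [ord0].  A state with verdict [Some b] halts with
   decision [b]; giving up without a decision is rendered by not halting. *)
Record multitape_tm (I : finType) := MultitapeTM {
  tm_extra : nat;
  tm_state : finType;
  tm_symbol : finType;
  tm_blank : tm_symbol;
  tm_input : I -> tm_symbol;
  tm_input_inj : injective tm_input;
  tm_input_nonblank : forall i, tm_input i <> tm_blank;
  tm_start : tm_state;
  tm_verdict : tm_state -> option bool;
  tm_trans : tm_state -> {ffun 'I_tm_extra.+1 -> tm_symbol} ->
             tm_state * {ffun 'I_tm_extra.+1 -> tm_symbol * move}
}.

Record tm_config (I : finType) (M : multitape_tm I) := TMConfig {
  conf_state : tm_state M;
  conf_tape : 'I_(tm_extra M).+1 -> int -> tm_symbol M;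
  conf_head : 'I_(tm_extra M).+1 -> int
}.

Definition tm_init (I : finType) (M : multitape_tm I) (w : seq I) :
    tm_config M :=
  @TMConfig I M (tm_start M)
    (fun j z =>
       if j == ord0 then
         if z is Posz n then nth (tm_blank M) (map (@tm_input I M) w) n
         else tm_blank M
       else tm_blank M)
    (fun _ => 0).

Definition tm_step (I : finType) (M : multitape_tm I) (c : tm_config M) :
    tm_config M :=
  if tm_verdict (conf_state c) is Some _ then c else
  let: (s, act) :=
    tm_trans (conf_state c) [ffun j => conf_tape c j (conf_head c j)] in
  @TMConfig I M s
    (fun j z => if z == conf_head c j then (act j).1 else conf_tape c j z)
    (fun j => conf_head c j + move_offset (act j).2).

(* Halted configurations are fixed by [tm_step], so this says that decision [b]
   is reached after at most [t] steps. *)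
Definition decides_within (I : finType) (M : multitape_tm I) (w : seq I)
    (t : nat) (b : bool) : Prop :=
  tm_verdict (conf_state (iter t (@tm_step I M) (tm_init M w))) = Some b.

End TuringMachines.

Section GenericCaseComplexity.

(* The pair (u, v) is presented as the word u # v; the separator # is [None]. *)
Definition encode_pair (X : Type) (p : seq X * seq X) : seq (option X) :=
  map some p.1 ++ None :: map some p.2.

Definition partial_algorithm (X : finType) := multitape_tm (option X).

Definition correct_for (X : finType) (D : set (seq X * seq X))
    (M : partial_algorithm X) : Prop :=
  forall p t b, decides_within M (encode_pair p) t b -> (b <-> D p).

Definition generically_linear_time (R : realType) (X : finType)
    (M : partial_algorithm X) : Prop :=
  exists S : set (seq X * seq X), generic R S /\
    exists c d : nat, forall p, S p ->
      exists b, decides_within M (encode_pair p) (c * pair_length p + d) b.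

Definition conjugacy_problem_generically_linear_time (R : realType)
    (G : groupType) : Prop :=
  forall (A : finType) (pi : A -> G), generates pi ->
    exists M : partial_algorithm (A + A)%type,
      correct_for (conjugacy_problem pi) M /\ generically_linear_time R M.

End GenericCaseComplexity.

(* Main.v *)
Require Import Defs.
From mathcomp Require Import all_boot all_order all_algebra finmap.
From mathcomp Require Import zify ring lra.
From mathcomp Require Import all_classical all_reals topology normedtype.
Set Implicit Arguments.
Unset Strict Implicit.
Unset Printing Implicit Defensive.
Import Order.TTheory GRing.Theory Num.Theory.
Import numFieldNormedType.Exports.
Local Open Scope classical_set_scope.
Local Open Scope ring_scope.

(** Since [G / [G, G]] is infinite and finitely generated, some nonzero
    [f : A -> Z] extends to a homomorphism from [G] to [Z]; it gives conjugate
    words the same weight. A machine reads [u # v] while the head of a second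
    tape moves to [weight f u - weight f v]; it rejects if that is nonzero and
    runs forever otherwise. Inverting [v] maps the undecided pairs of length [m]
    to words of length [m] and weight zero, with [m + 1] pairs for each word,
    so it remains to see that the random walk on [Z] with steps given by [f]
    returns to zero with probability tending to [0].

    For the latter, let [L] be the limit of the nonincreasing sequence
    [max_z P(S_m = z)]. If [L > 0], take [m] with [max_z P(S_m = z)] very
    close to [L] and [z] maximizing [P(S_(m+k) = z)]. This probability is an
    average of the numbers [P(S_m = z - weight u)] over the words [u] of length
    [k], so all of these are at least [L / 2]. But the words of length [k]
    take at least [k + 1] weights, which is impossible if [(k + 1) L > 2]. *)

(** * Words, weights and exponents *)

Definition invert_letter (A : Type) (x : A + A) : A + A :=
  match x with inl a => inr a | inr a => inl a end.

Definition invert_word (A : Type) (w : seq (A + A)) : seq (A + A) :=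
  rev (map (@invert_letter A) w).

Definition letter_weight (A : Type) (f : A -> int) (x : A + A) : int :=
  match x with inl a => f a | inr a => - f a end.

Definition weight (A : Type) (f : A -> int) (w : seq (A + A)) : int :=
  \sum_(x <- w) letter_weight f x.

(** The vector [exponent w] is the image of [w] in [Z^A], the abelianization of the free group on
    [A]. As a special weight, it inherits the lemmas on weights. *)
Definition exponent (A : eqType) (w : seq (A + A)) (a : A) : int :=
  weight (fun b => (b == a)%:R) w.

Lemma weight_cat (A : Type) (f : A -> int) u v :
  weight f (u ++ v) = weight f u + weight f v.
Proof. exact: big_cat. Qed.

Lemma weight_cons (A : Type) (f : A -> int) x w :
  weight f (x :: w) = letter_weight f x + weight f w.
Proof. exact: big_cons. Qed.

Lemma letter_weight_invert (A : Type) (f : A -> int) x :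
  letter_weight f (invert_letter x) = - letter_weight f x.
Proof. by case: x => a //=; rewrite opprK. Qed.

Lemma weight_map_invert (A : Type) (f : A -> int) w :
  weight f (map (@invert_letter A) w) = - weight f w.
Proof.
rewrite /weight big_map -sumrN.
by apply: eq_bigr => x _; rewrite letter_weight_invert.
Qed.

Lemma weight_invert (A : Type) (f : A -> int) w :
  weight f (invert_word w) = - weight f w.
Proof. by rewrite -weight_map_invert /weight /invert_word big_rev. Qed.

(** This turns a linear functional on [Z^A] that kills certain exponent vectors into a weight that
    vanishes on the corresponding words. *)
Lemma weight_exponent (A : finType) (f : A -> int) w :
  weight f w = \sum_a f a * exponent w a.
Proof.
elim: w => [|x w IHw].
  rewrite /weight big_nil big1// => a _.
  by rewrite /exponent /weight big_nil mulr0.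
rewrite weight_cons IHw /exponent.
under [RHS]eq_bigr do rewrite weight_cons mulrDr.
rewrite big_split/=; congr (_ + _).
case: x => b /=; rewrite (bigD1 b)//= eqxx ?mulr1 ?mulrN1 big1 ?addr0// => a.
  by rewrite eq_sym => /negbTE ->; rewrite mulr0.
by rewrite eq_sym => /negbTE ->; rewrite oppr0 mulr0.
Qed.

(** * Subgroups of [Z^A] and the functionals that kill them *)

Lemma sub_closed_mulz (A : Type) (L : set (A -> int))
    (L0 : L (fun=> 0))
    (LB : forall l m, L l -> L m -> L (fun a => l a - m a))
    (l : A -> int) (k : int) : L l -> L (fun a => k * l a).
Proof.
move=> Ll.
have LN m : L m -> L (fun a => - m a).
  move=> Lm; have -> : (fun a => - m a) = (fun a => 0 - m a).
    by apply/funext => a; rewrite sub0r.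
  exact: LB.
have Ln (n : nat) : L (fun a => n%:Z * l a).
  elim: n => [|n IHn]; first by under eq_fun do rewrite mul0r.
  have -> : (fun a => n.+1%:Z * l a) = (fun a => n%:Z * l a - - l a).
    by apply/funext => a; rewrite opprK -addn1 PoszD mulrDl mul1r.
  by apply: (LB) => //; exact: LN.
case: k => n; first exact: Ln.
under eq_fun do rewrite NegzE mulNr.
exact/LN/Ln.
Qed.

Lemma sub_closed_sum (A I : Type) (L : set (A -> int))
    (L0 : L (fun=> 0))
    (LB : forall l m, L l -> L m -> L (fun a => l a - m a))
    (r : seq I) (P : pred I) (l : I -> A -> int) :
  (forall i, P i -> L (l i)) -> L (fun a => \sum_(i <- r | P i) l i a).
Proof.
move=> Ll; elim: r => [|i r IHr]; first by under eq_fun do rewrite big_nil.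
under eq_fun do rewrite big_cons.
case Pi: (P i); last exact: IHr.
have -> : (fun a => l i a + \sum_(j <- r | P j) l j a) =
    (fun a => l i a - (0 - \sum_(j <- r | P j) l j a)).
  by apply/funext => a; rewrite sub0r opprK.
by apply: (LB); [exact: Ll|exact: LB].
Qed.

(* [S] is a maximal set of coordinates supporting no nonzero element of [L]:
   it indexes a basis of [Z^A / L] modulo torsion, and the functional found is
   a multiple of a coordinate function of that basis. *)
Lemma annihilator_or_finite_exponent (A : finType) (L : set (A -> int))
    (L0 : L (fun=> 0))
    (LB : forall l m, L l -> L m -> L (fun a => l a - m a)) :
  (exists2 f : A -> int, exists a, f a != 0 &
     forall l, L l -> \sum_a f a * l a = 0) \/
  (exists2 N : int, N != 0 & forall a, L (fun b => if b == a then N else 0)).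
Proof.
pose free (S : {set A}) := `[< forall l, L l ->
  (forall a, a \notin S -> l a = 0) -> forall a, l a = 0 >].
have free0 : free finset.set0.
  by apply/asboolP => l _ l0 a; apply: l0; rewrite finset.in_set0.
have [S maxS _] := maxset_exists free0.
have /maxsetP[/asboolP freeS maxlS] := maxS.
have rel1 a : a \notin S -> exists l, [/\ L l, l a != 0 &
    forall b, b \notin S -> b != a -> l b = 0].
  (* By maximality some nonzero [l] in [L] is supported on [S] and [a]; its coordinate at [a] is
     nonzero because [S] is free. *)
  move=> aS; have : ~~ free (a |: S).
    apply/negP => /maxlS /(_ (subsetU1 _ _)) /setP /(_ a).
    by rewrite finset.setU11 (negbTE aS).
  move=> /asboolP /existsNP[l] /not_implyP[Ll] /not_implyP[l0 nl].
  have l0' b : b \notin S -> b != a -> l b = 0.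
    by move=> bS ba; apply: l0; rewrite finset.in_setU1 negb_or ba.
  exists l; split => //; apply/eqP => la; apply: nl; apply: freeS => // b bS.
  by have [->//|ba] := eqVneq b a; apply: l0'.
have /choice[r rP] : forall a, exists l, a \notin S ->
    [/\ L l, l a != 0 & forall b, b \notin S -> b != a -> l b = 0].
  move=> a; have [aS|/rel1[l lP]] := boolP (a \in S); last by exists l.
  by exists (fun=> 0).
(* Rescaling each [r a] by the other diagonal entries gives [s a], which outside [S] agrees with [N]
   times the unit vector at [a]. *)
pose N : int := \prod_(a | a \notin S) r a a.
have N0 : N != 0 by apply/prodf_neq0 => a /rP[].
pose s a b : int := (\prod_(c | (c \notin S) && (c != a)) r c c) * r a b.
have Ls a : a \notin S -> L (s a).
  by move=> /rP[Lr _ _]; exact: sub_closed_mulz.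
have sa a : a \notin S -> s a a = N.
  by move=> aS; rewrite /s /N (bigD1 a aS)/= mulrC.
have sb a b : a \notin S -> b \notin S -> b != a -> s a b = 0.
  by move=> /rP[_ _ r0] bS ba; rewrite /s r0 ?mulr0.
have [S0|[a0 a0S]] := set_0Vmem S.
  right; exists N => // a.
  have -> : (fun b => if b == a then N else 0) = s a.
    apply/funext => b; have [->|ba] := eqVneq b a.
      by rewrite sa// S0 finset.in_set0.
    by rewrite sb// S0 finset.in_set0.
  by apply: Ls; rewrite S0 finset.in_set0.
left; exists (fun a => if a \in S then (if a == a0 then N else 0)
                       else - s a a0).
  by exists a0; rewrite a0S eqxx.
move=> l Ll.
(* Clearing the coordinates of [N l] outside [S] leaves an element of [L] supported on [S], hence
   zero. Its coordinate at [a0] is the value of the functional at [l]. *)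
pose m b := N * l b - \sum_(a | a \notin S) l a * s a b.
have Lm : L m.
  apply: (LB (fun b => N * l b)); first exact: sub_closed_mulz.
  by apply: (sub_closed_sum L0 LB) => a /Ls; exact: sub_closed_mulz.
have m0 : m a0 = 0.
  apply: freeS => // b bS.
  rewrite /m (bigD1 b bS)/= sa// mulrC big1 ?addr0 ?subrr// => a /andP[aS ab].
  by rewrite sb// ?mulr0// eq_sym.
rewrite -[RHS]m0 /m (bigID (mem S))/=; congr (_ + _).
  rewrite (bigD1 a0 a0S)/= a0S eqxx big1 ?addr0// => a /andP[aS /negbTE a_a0].
  by rewrite ifT// a_a0 mul0r.
rewrite -sumrN; apply: eq_bigr => a /negbTE ->.
by rewrite mulNr mulrC.
Qed.

(** * Values of words and the derived subgroup *)

Section Words.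
Local Open Scope group_scope.

Lemma subgroup_generated_subgroup (G : groupType) (S : set G) :
  subgroup (subgroup_generated S).
Proof.
split=> [|x y Sx Sy|x Sx] H [Hg SH]; case: (Hg) => H1 HM HV //.
  by apply: HM; [exact: Sx|exact: Sy].
by apply: HV; exact: Sx.
Qed.

Lemma commg_derived (G : groupType) (x y : G) : derived_subgroup G [~ x, y].
Proof. by move=> H [_]; apply; exists x, y. Qed.

Lemma word_value_cat (G : groupType) (A : finType) (pi : A -> G) u v :
  word_value pi (u ++ v) = word_value pi u * word_value pi v.
Proof. exact: big_cat. Qed.

Lemma word_value_cons (G : groupType) (A : finType) (pi : A -> G) x w :
  word_value pi (x :: w) = letter_value pi x * word_value pi w.
Proof. exact: big_cons. Qed.

Lemma letter_value_invert (G : groupType) (A : finType) (pi : A -> G) x :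
  letter_value pi (invert_letter x) = (letter_value pi x)^-1.
Proof. by case: x => a //=; rewrite invgK. Qed.

Lemma word_value_invert (G : groupType) (A : finType) (pi : A -> G) w :
  word_value pi (invert_word w) = (word_value pi w)^-1.
Proof.
elim: w => [|x w IHw]; first by rewrite /word_value !big_nil invg1.
rewrite /invert_word/= rev_cons -cats1 word_value_cat IHw !word_value_cons.
by rewrite invgM letter_value_invert /word_value big_nil mulg1.
Qed.

Lemma word_value_surj (G : groupType) (A : finType) (pi : A -> G) :
  generates pi -> forall g, exists w, word_value pi w = g.
Proof.
move=> gen_pi g; suff [w _ <-] : range (word_value pi) g by exists w.
have : [set: G] g by [].
rewrite -gen_pi; apply; split; last first.
  move=> _ [a _ <-]; exists [:: inl a] => //.
  by rewrite word_value_cons /word_value big_nil mulg1.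
split=> [|_ _ [u _ <-] [v _ <-]|_ [u _ <-]].
- by exists [::] => //; rewrite /word_value big_nil.
- by exists (u ++ v) => //; exact: word_value_cat.
- by exists (invert_word u) => //; exact: word_value_invert.
Qed.

Lemma exponent_ge0 (A : eqType) (a : A) w :
  inr a \notin w -> (0 <= exponent w a)%R.
Proof.
move=> aNw; rewrite /exponent /weight big_seq; apply: sumr_ge0 => -[] b //= bw.
by have [ba|_] := eqVneq b a; rewrite ?oppr0// -ba bw in aNw *.
Qed.

Lemma exponent_le0 (A : eqType) (a : A) w :
  inl a \notin w -> (exponent w a <= 0)%R.
Proof.
move=> aNw; rewrite /exponent /weight big_seq; apply: sumr_le0 => -[] b //= bw.
  by have [ba|_] := eqVneq b a; rewrite // -ba bw in aNw *.
by rewrite oppr_le0.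
Qed.

(* A word of exponent zero contains the inverse of its first letter, and
   cancelling the two multiplies its value by a commutator. *)
Lemma exponent0_derived (G : groupType) (A : finType) (pi : A -> G) w :
  (forall a, exponent w a = 0%R) -> derived_subgroup G (word_value pi w).
Proof.
have [D1 DM _] := subgroup_generated_subgroup
  [set z | exists x y : G, z = [~ x, y]].
have [n] := ubnP (size w); elim: n w => // n IHn [|x w] /= lt_wn w0.
  by rewrite /word_value big_nil.
have w_x : invert_letter x \in w.
  apply/negPn/negP => xNw.
  (* Without the inverse letter in [w], nothing offsets the contribution of [x], so the exponent of
     its generator is nonzero. *)
  case: x xNw w0 {lt_wn} => a aNw /(_ a);
    rewrite /exponent weight_cons /= eqxx mulr1n.
    by have := exponent_ge0 aNw; rewrite /exponent; set z := weight _ w; lia.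
  by have := exponent_le0 aNw; rewrite /exponent; set z := weight _ w; lia.
case/splitPr: w_x lt_wn w0 => u v; rewrite size_cat/= => lt_wn w0.
have -> : word_value pi (x :: u ++ invert_letter x :: v) =
    [~ (letter_value pi x)^-1, (word_value pi u)^-1] * word_value pi (u ++ v).
  rewrite !(word_value_cons, word_value_cat) letter_value_invert.
  by rewrite commgEl conjgE !invgK !mulgA mulgVK.
apply: DM; first exact: commg_derived.
apply: IHn => [|a]; first by rewrite size_cat ltnW// -addnS.
rewrite -(w0 a) /exponent !(weight_cons, weight_cat).
by rewrite letter_weight_invert [RHS]addrCA addNKr.
Qed.

End Words.

(** * A weight invariant under conjugation *)

Section Abelianization.
Local Open Scope group_scope.

Lemma exponent_nseq (A : eqType) n (a b : A) :
  exponent (nseq n (inl a)) b = (if a == b then n%:Z else 0)%R.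
Proof.
rewrite /exponent /weight big_nseq; elim: n => [|n IHn] /=; first by case: eqP.
by rewrite IHn; case: eqP => _; rewrite ?add0r// -natrD.
Qed.

Lemma exponent_flatten (A : finType) (r : A -> nat) (b : A) :
  exponent (flatten [seq nseq (r a) (inl a) | a <- enum A]) b = (r b)%:Z.
Proof.
transitivity (\sum_(a : A) exponent (nseq (r a) (inl a)) b)%R.
  rewrite -big_enum/=; elim: (enum A) => [|a s IHs] /=.
    by rewrite /exponent /weight !big_nil.
  by rewrite big_cons -IHs /exponent weight_cat.
rewrite (bigD1 b)//= exponent_nseq eqxx big1 ?addr0// => a ab.
by rewrite exponent_nseq (negbTE ab).
Qed.

Lemma conjugate_weight (G : groupType) (A : finType) (pi : A -> G) :
    generates pi -> infinite_set (abelianization G) ->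
  exists2 f : A -> int, exists a, (f a != 0)%R &
    forall u v, conjugate_in (word_value pi u) (word_value pi v) ->
      weight f u = weight f v.
Proof.
move=> gen_pi infG.
have [D1 DM DV] : subgroup (derived_subgroup G).
  exact: subgroup_generated_subgroup.
(* [L] is the kernel of the map from [Z^A] onto [G / [G, G]]. *)
pose L : set (A -> int) := [set l | exists2 w,
  derived_subgroup G (word_value pi w) & exponent w = l].
have L0 : L (fun=> 0%R).
  exists [::]; first by rewrite /word_value big_nil.
  by apply/funext => a; rewrite /exponent /weight big_nil.
have LB l m : L l -> L m -> L (fun a => (l a - m a)%R).
  move=> [u Du <-] [v Dv <-]; exists (u ++ invert_word v).
    by rewrite word_value_cat word_value_invert; apply: (DM) => //; exact: DV.
  by apply/funext => a; rewrite /exponent weight_cat weight_invert.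
have [[f f0 fL]|[N N0 NL]] := annihilator_or_finite_exponent L0 LB.
  (* If [u] and [v] have conjugate values, the value of [u v^-1] is a commutator, so its exponent
     vector lies in [L] and [f] kills it. *)
  exists f => // u v [g uv].
  suff /fL : L (exponent (u ++ invert_word v)).
    by rewrite -weight_exponent weight_cat weight_invert => /subr0_eq.
  exists (u ++ invert_word v) => //.
  rewrite word_value_cat word_value_invert -uv.
  have -> : word_value pi u * (word_value pi u ^ g)^-1 =
      [~ (word_value pi u)^-1, g].
    by rewrite commgEl invgK conjVg.
  exact: commg_derived.
(* Here [L] contains [N Z^A], so the finitely many words [w_ r] with exponents reduced modulo [N]
   represent all cosets, and the abelianization would be finite. *)
exfalso; apply: infG.
have N1 : (0 < `|N|)%N by rewrite absz_gt0.
pose w_ (r : {ffun A -> 'I_`|N|}) :=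
  flatten [seq nseq (r a) (inl a) | a <- enum A] : seq (A + A).
apply: (@sub_finite_set _ _ (range (fun r =>
    left_coset (@derived_subgroup G) (word_value pi (w_ r))))); last first.
  exact/finite_image/finite_finset.
move=> _ [g _ <-]; have [w <-] := word_value_surj gen_pi g.
have lt_mod a : (`|(exponent w a %% N)%Z| < `|N|)%N.
  by rewrite -ltz_nat gez0_abs ?modz_ge0// ltz_mod.
pose r := [ffun a => Ordinal (lt_mod a)].
exists r => //.
have [v Dv vE] : L (fun a => (exponent w a - exponent (w_ r) a)%R).
  have -> : (fun a => (exponent w a - exponent (w_ r) a)%R) =
      (fun b => \sum_a (exponent w a %/ N)%Z * (if b == a then N else 0))%R.
    apply/funext => b; rewrite (bigD1 b)//= eqxx big1 ?addr0; last first.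
      by move=> a /negbTE; rewrite eq_sym => ->; rewrite mulr0.
    rewrite exponent_flatten ffunE/= gez0_abs ?modz_ge0//.
    by rewrite {1}(divz_eq (exponent w b) N) addrK.
  by apply: sub_closed_sum => // a _; exact: sub_closed_mulz.
have Dwr : derived_subgroup G ((word_value pi (w_ r))^-1 * word_value pi w).
  (* The word [v] absorbs the difference of exponents: all exponents of this product are zero, and
     the value of [v] is itself in the derived subgroup. *)
  have : derived_subgroup G
      (word_value pi (invert_word (w_ r) ++ w ++ invert_word v)).
    apply: exponent0_derived => a.
    have := congr1 (@^~ a) vE; rewrite /= /exponent !weight_cat !weight_invert.
    by move=> ->; rewrite addrA [(- _ + _)%R]addrC subrr.
  rewrite !word_value_cat !word_value_invert mulgA => D.
  by rewrite -[X in _ X](mulgVK (word_value pi v)); exact: DM.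
apply/seteqP; split=> _ [h Dh <-].
  exists (((word_value pi (w_ r))^-1 * word_value pi w)^-1 * h).
    by apply: (DM) => //; exact: DV.
  by rewrite invgM invgK !mulgA mulgV mul1g.
exists (((word_value pi (w_ r))^-1 * word_value pi w) * h); first exact: DM.
by rewrite !mulgA mulgV mul1g.
Qed.

End Abelianization.

(** * Random walks on the integers *)

Section Walk.
Variables (R : realType) (X : finType) (f : X -> int).

(** The number of words of length [m] over [X] whose values under [f] sum to [z], computed by
    removing one letter; [card_tuple_sum] identifies the two. *)
Fixpoint walk_count (m : nat) (z : int) : nat :=
  if m is m'.+1 then (\sum_x walk_count m' (z - f x))%N else (z == 0).

Definition walk_prob (m : nat) (z : int) : R :=
  (walk_count m z)%:R / #|X|%:R ^+ m.

Lemma walk_prob_ge0 m z : 0 <= walk_prob m z.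
Proof. by rewrite divr_ge0// exprn_ge0. Qed.

Hypothesis X_gt0 : (0 < #|X|)%N.

Let N_gt0 : 0 < #|X|%:R :> R. Proof. by rewrite ltr0n. Qed.

Lemma walk_probS m z :
  #|X|%:R * walk_prob m.+1 z = \sum_x walk_prob m (z - f x).
Proof.
rewrite /walk_prob /= -mulr_suml -natr_sum exprS invfM mulrCA.
by rewrite [X in _ * X]mulrA divff ?mul1r// lt0r_neq0.
Qed.

(** Each further step averages the distribution over translates, so a uniform bound persists. *)
Lemma walk_prob_bound m n B : (m <= n)%N ->
  (forall z, walk_prob m z <= B) -> forall z, walk_prob n z <= B.
Proof.
move=> /subnK <- + ; elim: (n - m)%N => // d IHd mB z.
rewrite addSn -(ler_pM2l N_gt0) walk_probS.
apply: (@le_trans _ _ (\sum_(x : X) B)); first by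
  apply: ler_sum => x _; exact: IHd.
by rewrite sumr_const mulr_natl.
Qed.

(* An average of numbers at most [B] that is close to [B] has all its terms
   close to [B]. *)
Lemma walk_prob_near_bound m B e z x :
    (forall z, walk_prob m z <= B) -> B - e <= walk_prob m.+1 z ->
  B - #|X|%:R * e <= walk_prob m (z - f x).
Proof.
move=> mB; rewrite -(ler_pM2l N_gt0) walk_probS (bigD1 x)//= => le_sum.
have : \sum_(y | y != x) walk_prob m (z - f y) <= \sum_(y | y != x) B.
  by apply: ler_sum.
rewrite sumr_const cardC1 -[B *+ _]mulr_natl -subn1 natrB// mulrBl mul1r.
by move: le_sum; rewrite mulrBr; lra.
Qed.

(** The one-step estimate is applied once per letter of [u]; each application multiplies the defect
    [e] by the size of the alphabet. *)
Lemma walk_prob_near_bound_word m B e z (u : seq X) :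
    (forall z, walk_prob m z <= B) -> B - e <= walk_prob (size u + m) z ->
  B - #|X|%:R ^+ size u * e <= walk_prob m (z - \sum_(x <- u) f x).
Proof.
move=> mB; elim: u z e => [|x u IHu] z e /=.
  by rewrite big_nil mul1r subr0 add0n.
rewrite big_cons exprSr -mulrA opprD addrA => le_z.
apply: IHu; apply: walk_prob_near_bound le_z.
exact: walk_prob_bound (leq_addl _ _) mB.
Qed.

Lemma sum_walk_prob_le1 m (s : seq int) :
  uniq s -> \sum_(z <- s) walk_prob m z <= 1.
Proof.
elim: m s => [|m IHm] s s_uniq.
  under eq_bigr do rewrite /walk_prob expr0 divr1 /=.
  rewrite -natr_sum -[leRHS]/(1%:R) ler_nat.
  have -> : (\sum_(z <- s) (z == 0%R) = count_mem 0%R s)%N.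
    by rewrite -sum1_count [RHS]big_mkcond/=; apply: eq_bigr => z _; case: eqP.
  by rewrite count_uniq_mem// leq_b1.
rewrite -(ler_pM2l N_gt0) mulr_sumr.
under eq_bigr do rewrite walk_probS.
rewrite exchange_big/= mulr1.
apply: (@le_trans _ _ (\sum_(x : X) 1)); last by rewrite sumr_const.
apply: ler_sum => x _.
have := IHm [seq z - f x | z <- s].
by by rewrite big_map map_inj_uniq ?s_uniq; [apply|exact: addIr].
Qed.

Lemma walk_prob_to0 x y : f x != f y -> forall e, 0 < e ->
  exists m0, forall m z, (m0 <= m)%N -> walk_prob m z <= e.
Proof.
move=> fxy e e_gt0.
(* The infimum of [E] is the limit [L] of the maximal probabilities; no maximum has to be named. *)
pose E : set R := [set B | exists m, forall z, walk_prob m z <= B].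
have E1 : E 1.
  exists 0%N => z; have := @sum_walk_prob_le1 0 [:: z] isT.
  by rewrite big_seq1.
have E_lb : lbound E 0.
  by move=> B [m mB]; exact: le_trans (walk_prob_ge0 _ _) (mB 0).
have infE : has_inf E by split; [exists 1|exists 0].
suff L_le0 : inf E <= 0.
  have [B [m mB] lt_B] := inf_adherent e_gt0 infE.
  exists m => n z le_mn; apply: le_trans (walk_prob_bound le_mn mB z) _.
  lra.
rewrite leNgt; apply/negP; set L := inf E => L_gt0.
(* This [k] makes [(k + 1) L / 2] exceed 1, and [d] below is chosen so that a defect of [2 d],
   amplified over [k] letters, is exactly [L / 2]. *)
pose k := Num.bound (2 / L).
have lt_k : 2 / L < k%:R by apply: archi_boundP; rewrite divr_ge0// ltW.
have Nk_gt0 : 0 < #|X|%:R ^+ k :> R by rewrite exprn_gt0.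
pose d := L / (4 * #|X|%:R ^+ k).
have d_gt0 : 0 < d by rewrite divr_gt0// mulr_gt0.
have [B [m mB] lt_B] := inf_adherent d_gt0 infE.
have le_LB : L <= B by apply: ge_inf; [exists 0|exists m].
(* Otherwise [L - d] would belong to [E]. Since [B < L + d], the probability at [z] is within [2 d]
   of [B]. *)
have [z z_gt] : exists z, L - d < walk_prob (k + m) z.
  apply: contrapT => /forallNP nz.
  suff : L <= L - d by lra.
  apply: ge_inf; first by exists 0.
  by exists (k + m)%N => z; rewrite leNgt; exact/negP.
(* The words [x^j y^(k-j)] for [j <= k] have distinct sums because [f x] and [f y] differ. *)
pose u j := nseq j x ++ nseq (k - j) y.
have su j : (j <= k)%N -> size (u j) = k.
  by move=> jk; rewrite size_cat !size_nseq subnKC.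
pose s := [seq z - \sum_(t <- u j) f t | j <- iota 0 k.+1].
have s_uniq : uniq s.
  rewrite map_inj_in_uniq ?iota_uniq// => i j.
  rewrite !mem_iota !add0n !ltnS => /andP[_ ik] /andP[_ jk] /addrI/oppr_inj.
  rewrite !big_cat/= !big_nseq !iter_addr_0 !mulrnBr//.
  move=> ij; apply: (@mulrIn _ (f x - f y)); first by rewrite subr_eq0.
  by rewrite !mulrnBl; move: ij; set a := f x *+ _; set b := f y *+ _; lia.
have := sum_walk_prob_le1 m s_uniq.
apply/negP; rewrite -ltNge big_map.
apply: (@lt_le_trans _ _ (\sum_(j <- iota 0 k.+1) L / 2)).
  rewrite big_const_seq count_predT size_iota iter_addr_0 -[ltRHS]mulr_natl.
  move: lt_k; rewrite ltr_pdivrMr// -[k.+1%:R]natr1; lra.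
rewrite big_seq [leRHS]big_seq; apply: ler_sum => j.
rewrite mem_iota add0n ltnS => /andP[_ jk].
have := @walk_prob_near_bound_word m B (2 * d) z (u j) mB.
rewrite su// => /(_ _)/wrap[]; first by lra.
apply: le_trans.
have -> : #|X|%:R ^+ k * (2 * d) = L / 2.
  by rewrite /d; field; rewrite lt0r_neq0.
lra.
Qed.

End Walk.

(** * Counting pairs of words *)

Lemma card_tuple_sum (X : finType) (f : X -> int) m z :
  #|[pred w : m.-tuple X | \sum_(x <- w) f x == z]| = walk_count f m z.
Proof.
elim: m z => [|m IHm] z /=.
  rewrite -sum1_card big_mkcond/= (big_pred1 [tuple]) => [|w]; last first.
    by apply/esym/eqP; exact: tuple0.
  by rewrite inE big_nil eq_sym; case: eqP.
under eq_bigr do rewrite -IHm -sum1_card.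
rewrite pair_big_dep/= -sum1_card.
rewrite (reindex (fun p : X * m.-tuple X => [tuple of p.1 :: p.2])) /=.
  apply: eq_bigl => -[x w]; rewrite !inE/= big_cons.
  by rewrite [RHS]eq_sym subr_eq eq_sym addrC.
exists (fun w => (thead w, [tuple of behead w])) => [[x w] _|w _] /=.
  by rewrite theadE; congr pair; exact: val_inj.
by rewrite [in RHS](tuple_eta w).
Qed.

(** A word of length [m <= n] with one of its [m + 1] cutting points: a finite type that enumerates
    the ball of radius [n]. *)
Definition split_words (X : finType) (n : nat) : finType :=
  {m : 'I_n.+1 & ('I_m.+1 * m.-tuple X)%type}.

(* Inverting the second word turns the difference of the weights of a pair into
   the weight of a single word. *)
Definition split_pair (A : finType) n (t : split_words (A + A)%type n) :
    seq (A + A) * seq (A + A) :=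
  let: existT _ (i, w) := t in
  (take i w, map (@invert_letter A) (drop i w)).

Lemma invert_letterK (A : Type) : involutive (@invert_letter A).
Proof. by case. Qed.

Lemma split_pair_inj (A : finType) n : injective (@split_pair A n).
Proof.
move=> [m [i w]] [m' [i' w']] [take_eq drop_eq].
have drop_eq' : drop i w = drop i' w'.
  exact: (inj_map (can_inj (@invert_letterK A))) drop_eq.
have w_eq : w = w' :> seq _.
  by rewrite -(cat_take_drop i w) take_eq drop_eq' cat_take_drop.
have mm' : m = m'.
  by apply: val_inj; rewrite /= -(size_tuple w) w_eq size_tuple.
subst m'; have -> : w = w' by exact: val_inj.
suff -> : i = i' by [].
apply: val_inj => /=; have := congr1 size take_eq.
by rewrite !size_takel// size_tuple -ltnS.
Qed.

Lemma split_pair_ball (A : finType) n p :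
  @Defs.ball (A + A)%type n p <-> exists t, @split_pair A n t = p.
Proof.
split=> [|[[m [i w]] <-]]; last first.
  rewrite /Defs.ball /pair_length /= size_map -size_cat cat_take_drop.
  by rewrite size_tuple -ltnS.
case: p => u v; rewrite /Defs.ball /pair_length /= -ltnS => uv_n.
have u_uv : (size u < (size u + size v).+1)%N by rewrite ltnS leq_addr.
have w_uv : size (u ++ map (@invert_letter A) v) == (size u + size v)%N.
  by rewrite size_cat size_map.
exists (existT _ (Ordinal uv_n) (Ordinal u_uv, Tuple w_uv)) => /=.
by rewrite take_size_cat// drop_size_cat// mapK//; exact: invert_letterK.
Qed.

Lemma card_setI_ball (A : finType) n (S : set (seq (A + A) * seq (A + A))) :
  #|` fset_set (S `&` @Defs.ball (A + A)%type n)| =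
  #|[pred t : split_words (A + A)%type n | `[< S (split_pair t) >]]|.
Proof.
set Q := [pred t | _].
have -> : fset_set (S `&` @Defs.ball (A + A)%type n) =
    [fset x in [seq split_pair t | t <- enum Q]]%fset.
  apply/fsetP => p; rewrite in_fset_set; last first.
    exact/finite_setIr/finite_ball.
  rewrite !inE; apply/idP/mapP => [/set_mem [Sp /split_pair_ball[t tp]]|].
    by exists t; rewrite ?mem_enum ?tp//; apply/asboolP; rewrite tp.
  move=> [t]; rewrite mem_enum => /asboolP St ->.
  by apply/mem_set; split=> //; apply/split_pair_ball; exists t.
rewrite card_fseq undup_id ?size_map -?cardE//.
by rewrite map_inj_uniq ?enum_uniq//; exact: split_pair_inj.
Qed.

Lemma card_split_words (X : finType) n (P : pred (seq X)) :
  #|[pred t : split_words X n | P (tagged t).2]| =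
  (\sum_(m < n.+1) m.+1 * #|[pred w : m.-tuple X | P w]|)%N.
Proof.
transitivity (\sum_(m < n.+1) \sum_(q : 'I_m.+1 * m.-tuple X | P q.2) 1)%N.
  by rewrite sig_big_dep/= -sum1_card; apply: eq_bigl => -[m q].
apply: eq_bigr => m _.
rewrite -(pair_big xpredT (fun w : m.-tuple X => P w) (fun _ _ => 1%N))/=.
by rewrite sum_nat_const card_ord sum1_card.
Qed.

(** A Cesaro argument: the terms before [m0] contribute at most a constant [C], while the sum of the
    [b m] is at least [n] and eventually dominates it. *)
Lemma weighted_average_to0 (R : realType) (c b : nat -> R) :
    (forall m, 0 <= c m <= b m) -> (forall m, 1 <= b m) ->
    (forall e : R, 0 < e ->
      exists m0, forall m, (m0 <= m)%N -> c m <= e * b m) ->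
  forall e : R, 0 < e -> exists n0, forall n, (n0 <= n)%N ->
    \sum_(m < n) c m <= e * \sum_(m < n) b m.
Proof.
move=> c_b b_ge1 c_small e e_gt0.
have e2_gt0 : 0 < e / 2 by rewrite divr_gt0.
have [m0 m0P] := c_small _ e2_gt0.
pose C := \sum_(m < m0) b m.
have b_ge0 m : 0 <= b m by apply: le_trans (b_ge1 m).
have C_ge0 : 0 <= C by apply: sumr_ge0.
pose k := Num.bound (C / (e / 2)).
have k_gt : C / (e / 2) < k%:R by apply: archi_boundP; rewrite divr_ge0// ltW.
exists k => n kn.
have n_le : n%:R <= \sum_(m < n) b m.
  rewrite -[n in n%:R]card_ord -sumr_const; exact: ler_sum.
have C_le : C <= e / 2 * \sum_(m < n) b m.
  rewrite mulrC -ler_pdivrMr//; apply: le_trans n_le.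
  by apply: le_trans (ltW k_gt) _; rewrite ler_nat.
have : \sum_(m < n) c m <= C + e / 2 * \sum_(m < n) b m.
  elim: n {kn n_le C_le} => [|n IHn]; first by rewrite !big_ord0 mulr0 addr0.
  have [le_m0|lt_m0] := leqP m0 n.
    by rewrite !big_ord_recr/= mulrDr addrA lerD// m0P.
  apply: (@le_trans _ _ C); last first.
    by rewrite lerDl mulr_ge0 ?sumr_ge0// ltW.
  apply: (@le_trans _ _ (\sum_(m < n.+1) b m)).
    by apply: ler_sum => m _; case/andP: (c_b m).
  rewrite /C -!(big_mkord xpredT) [leRHS](big_cat_nat (n := n.+1))//=.
  by rewrite lerDl sumr_ge0.
lra.
Qed.

Lemma generic_weight_neq (R : realType) (A : finType) (f : A -> int) a :
  f a != 0 -> generic R [set p | weight f p.1 != weight f p.2].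
Proof.
move=> fa; rewrite /generic.
set S := [set p | _]; pose X : finType := (A + A)%type.
have X_gt0 : (0 < #|X|)%N by apply/card_gt0P; exists (inl a).
(* Among the pairs of length [m], [b m] counts all and [c m] those of equal weights; the factor
   [m.+1] counts the cuts of one word. *)
pose c m : nat := (m.+1 * walk_count (letter_weight f) m 0)%N.
pose b m : nat := (m.+1 * #|X| ^ m)%N.
have bE n : #|` fset_set (@Defs.ball X n)| = (\sum_(m < n.+1) b m)%N.
  rewrite -[X in fset_set X]setTI card_setI_ball.
  transitivity #|[pred t : split_words X n | xpredT (tagged t).2]|.
    by apply: eq_card => t; rewrite !inE; apply/asboolP.
  rewrite (@card_split_words X n xpredT); apply: eq_bigr => m _.
  by rewrite /b -card_tuple.
have cE n : (#|` fset_set (S `&` @Defs.ball X n)| + \sum_(m < n.+1) c m =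
    \sum_(m < n.+1) b m)%N.
  rewrite -bE -[X in _ = #|` fset_set X|]setTI !card_setI_ball.
  pose P (w : seq X) := \sum_(x <- w) letter_weight f x == 0.
  have -> : (\sum_(m < n.+1) c m =
      #|[pred t : split_words X n | P (tagged t).2]|)%N.
    rewrite (card_split_words n P); apply: eq_bigr => m _.
    by rewrite /c card_tuple_sum.
  rewrite [RHS](_ : _ = #|split_words X n|); last first.
    by apply: eq_card => t; rewrite !inE; apply/asboolP.
  rewrite addnC -(cardC [pred t : split_words X n | P (tagged t).2]).
  congr addn; apply: eq_card => -[m [i w]]; rewrite !inE /S/=.
  have -> : P w = (weight f (take i w) ==
      weight f (map (@invert_letter A) (drop i w))).
    by rewrite weight_map_invert -addr_eq0 -weight_cat cat_take_drop.
  by rewrite asboolb.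
have b_gt0 n : (0 < \sum_(m < n.+1) b m)%N.
  by rewrite big_ord_recl addn_gt0 /b muln1.
have densE n : 1 - density R S n =
    (\sum_(m < n.+1) (c m)%:R) / \sum_(m < n.+1) (b m)%:R.
  rewrite /density bE -!natr_sum.
  rewrite -{1}(divff (x := (\sum_(m < n.+1) b m)%:R)) ?pnatr_eq0 -?lt0n//.
  by rewrite -mulrBl -[in X in X - _](cE n) natrD addrAC subrr add0r.
apply/cvgrPdist_le => e e_gt0.
(* The walk has two distinct steps, since [f a] and [- f a] differ when [f a] is nonzero. *)
have f_neq : letter_weight f (inl a) != letter_weight f (inr a).
  by rewrite /=; move: fa; lia.
have [n0 n0P] : exists n0, forall n, (n0 <= n)%N ->
    \sum_(m < n) (c m)%:R <= e * \sum_(m < n) (b m)%:R :> R.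
  apply: (@weighted_average_to0 R (fun m => (c m)%:R) (fun m => (b m)%:R)) =>
    // [m|m|d d_gt0].
  - rewrite ler0n ler_nat /c /b leq_mul2l/=.
    rewrite -card_tuple_sum -card_tuple; exact: max_card.
  - by rewrite ler1n /b muln_gt0 expn_gt0 X_gt0.
  have [m0 m0P] := walk_prob_to0 X_gt0 f_neq d_gt0.
  exists m0 => m /(m0P m 0); rewrite /walk_prob ler_pdivrMr; last first.
    by rewrite exprn_gt0// ltr0n.
  by rewrite /c /b !natrM natrX mulrCA; exact: ler_wpM2l.
near=> n.
rewrite densE ger0_norm; last by rewrite divr_ge0// sumr_ge0.
rewrite ler_pdivrMr; last by rewrite -natr_sum ltr0n.
by apply: n0P; rewrite leqW//; near: n; exact: nbhs_infty_ge.
Unshelve. all: by end_near. Qed.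

(** * The machine *)

Section WeightMachine.
Variables (A : finType) (f : A -> int).

Let X : finType := (A + A)%type.
(** No letter moves the second head by more than [bound] cells, so the pending moves fit into a
    finite state. *)
Let bound : nat := \max_(x : X) `|letter_weight f x|%N.

(* [None] is the blank and [Some None] marks the origin of the second tape. *)
Definition weight_symbol : finType := option (option (option X)).

(* [inl (r, up, second)]: reading the first or the second word, with [r] moves
   of the second head pending in direction [up]; [inr None] is the initial
   state, [inr (Some true)] rejects and [inr (Some false)] loops. *)
Definition weight_state : finType :=
  ('I_bound.+1 * bool * bool + option bool)%type.

(** The position of the second head is the counter. At the end of the input, the marked origin tells
    whether it is zero. *)
Definition weight_action (s : weight_state) (a1 a2 : weight_symbol) :
    weight_state * weight_symbol * move * move :=
  match s with
  | inr None => (inl (ord0, true, false), Some None, Stay, Stay)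
  | inr (Some _) => (s, a2, Stay, Stay)
  | inl (r, up, second) =>
    if (0 < r)%N then
      (inl (inord r.-1, up, second), a2, Stay,
       if up then MoveRight else MoveLeft)
    else match a1 with
      | Some (Some (Some x)) =>
        let d := if second then - letter_weight f x else letter_weight f x in
        (inl (inord `|d|%N, 0 <= d, second), a2, MoveRight, Stay)
      | Some (Some None) => (inl (ord0, up, true), a2, MoveRight, Stay)
      | _ => (inr (Some (a2 != Some None)), a2, Stay, Stay)
      end
  end.

Definition weight_trans (s : weight_state)
    (a : {ffun 'I_2 -> weight_symbol}) :
    weight_state * {ffun 'I_2 -> weight_symbol * move} :=
  let: (s', b, m1, m2) := weight_action s (a ord0) (a ord_max) in
  (s', [ffun j => if j == ord0 then (a ord0, m1) else (b, m2)]).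

(** Only rejection is a verdict: different weights exclude conjugacy, but equal weights settle
    nothing. *)
Definition weight_verdict (s : weight_state) : option bool :=
  if s is inr (Some true) then Some false else None.

Definition weight_input (i : option X) : weight_symbol := Some (Some i).

Lemma weight_input_inj : injective weight_input.
Proof. by move=> i j []. Qed.

Lemma weight_input_nonblank i : weight_input i <> None.
Proof. by []. Qed.

Definition weight_machine : partial_algorithm X :=
  @MultitapeTM _ 1 weight_state weight_symbol None weight_input weight_input_inj
    weight_input_nonblank (inr None) weight_verdict weight_trans.

Let input (w : seq (option X)) (z : int) : weight_symbol :=
  if z is Posz n then nth None (map weight_input w) n else None.

Let mark (z : int) : weight_symbol := if z == 0 then Some None else None.

(** After the first step the tapes no longer change, so the state and the two head positions
    describe the whole configuration. *)
Let cfg w s n h : tm_config weight_machine :=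
  @TMConfig _ weight_machine s
    (fun j z => if j == ord0 then input w z else mark z)
    (fun j => if j == ord0 then n else h).

Let step := @tm_step _ weight_machine.

Lemma step_cfg w s n h s' m1 m2 :
  weight_verdict s = None ->
  weight_action s (input w n) (mark h) = (s', mark h, m1, m2) ->
  step (cfg w s n h) = cfg w s' (n + move_offset m1) (h + move_offset m2).
Proof.
move=> sN sE; rewrite /step /tm_step /= sN /weight_trans !ffunE /= sE /cfg.
congr TMConfig; apply/funext => j; last by rewrite ffunE; case: ifP.
by apply/funext => z; rewrite ffunE; case: (j == ord0); case: eqP => [->|].
Qed.

Definition reaches T (c c' : tm_config weight_machine) : Prop :=
  exists2 t, (t <= T)%N & iter t step c = c'.

Lemma reaches_trans T U c d e :
  reaches T c d -> reaches U d e -> reaches (T + U) c e.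
Proof.
move=> [t tT <-] [u uU <-]; exists (u + t)%N; first by rewrite addnC leq_add.
exact: iterD.
Qed.

Lemma reaches1 c : reaches 1 c (step c).
Proof. by exists 1%N. Qed.

Lemma reaches_moves w n (r : nat) (up second : bool) h : (r <= bound)%N ->
  reaches r (cfg w (inl (inord r, up, second)) n h)
    (cfg w (inl (ord0, up, second)) n (h + (if up then r%:Z else - r%:Z))).
Proof.
elim: r h => [|r IHr] h r_le.
  exists 0%N => //=; congr (cfg w (inl (_, _, _)) n _).
    by apply: val_inj; rewrite /= inordK.
  by case: up; rewrite ?oppr0 addr0.
rewrite -add1n; apply: reaches_trans (reaches1 _) _.
have -> : h + (if up then r.+1%:Z else - r.+1%:Z) =
    h + move_offset (if up then MoveRight else MoveLeft) +
    (if up then r%:Z else - r%:Z) by case: (up) => /=; lia.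
rewrite (@step_cfg _ _ _ _ (inl (inord r, up, second)) Stay
  (if up then MoveRight else MoveLeft))//.
  by rewrite addr0; apply: IHr; exact: ltnW.
by rewrite /= inordK.
Qed.

Lemma reaches_letter w n x up second h : nth None w n = Some x ->
    (n < size w)%N ->
  exists up', reaches bound.+1
    (cfg w (inl (ord0, up, second)) n h)
    (cfg w (inl (ord0, up', second)) n.+1
       (h + if second then - letter_weight f x else letter_weight f x)).
Proof.
move=> wn nw; set d := if second then _ else _; exists (0 <= d).
have d_le : (`|d| <= bound)%N.
  have : (`|letter_weight f x| <= bound)%N.
    exact: (leq_bigmax (F := fun x => `|letter_weight f x|%N)).
  by rewrite /d; case: second {d}; rewrite ?abszN.
rewrite -[X in reaches X]add1n; apply: reaches_trans (reaches1 _) _.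
rewrite (@step_cfg _ _ _ _ (inl (inord `|d|%N, 0 <= d, second)) MoveRight
  Stay)//.
  have -> : n.+1%:Z = n%:Z + move_offset MoveRight by rewrite /=; lia.
  have -> : h + d = h + if 0 <= d then `|d|%N%:Z else - `|d|%N%:Z.
    by congr (h + _); case: ifP; lia.
  rewrite addr0.
  have [t t_le tE] := reaches_moves w (n%:Z + 1) (0 <= d) second h d_le.
  by exists t => //; exact: leq_trans t_le d_le.
by rewrite /= (nth_map None)// wn.
Qed.

(** The contexts [pre] and [post] let one induction serve both words of the pair. *)
Lemma reaches_word (pre post : seq (option X)) u up second h :
  let w := pre ++ map some u ++ post in
  exists up', reaches (bound.+1 * size u)
    (cfg w (inl (ord0, up, second)) (size pre) h)
    (cfg w (inl (ord0, up', second)) (size pre + size u)%N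
       (h + if second then - weight f u else weight f u)).
Proof.
elim: u pre up h => [|x u IHu] pre up h w.
  exists up, 0%N => //=; rewrite addn0 /weight big_nil.
  by case: second; rewrite ?oppr0 addr0.
have wn : nth None w (size pre) = Some x by rewrite nth_cat ltnn subnn.
have nw : (size pre < size w)%N by rewrite size_cat/= addnS ltnS leq_addr.
have [up1 reach1] := reaches_letter up second h wn nw.
have [up2] := IHu (rcons pre (Some x)) up1
  (h + if second then - letter_weight f x else letter_weight f x).
rewrite cat_rcons size_rcons => reach2.
exists up2; rewrite /= mulnS; apply: reaches_trans reach1 _.
move: reach2; rewrite addSnnS -addrA weight_cons.
by case: (second); rewrite ?opprD.
Qed.

Lemma reaches_verdict p :
  exists n h, reaches (bound.+1 * pair_length p + 3)
    (tm_init weight_machine (encode_pair p))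
    (cfg (encode_pair p) (inr (Some (weight f p.1 != weight f p.2))) n h).
Proof.
case: p => u v; set w := encode_pair _.
pose c0 := cfg w (inl (ord0, true, false)) 0 0.
have start : step (tm_init weight_machine w) = c0.
  rewrite /step /tm_step /= /weight_trans /= /c0 /cfg; congr TMConfig.
    apply/funext => j; apply/funext => z; rewrite !ffunE/=.
    case: ifP => [/eqP->|z0]; last by case: eqP; rewrite // /mark z0.
    by rewrite /= /mark; case: eqP.
  by apply/funext => j; rewrite ffunE/=; case: eqP.
have [up1 reach1] := reaches_word [::] (None :: map some v) u true false 0.
have wE : w = rcons (map some u) None ++ map some v ++ [::].
  by rewrite cats0 cat_rcons.
have [up2] := reaches_word (rcons (map some u) None) [::] v up1 true
  (weight f u).
rewrite -wE => reach2.
exists (size u + (size v).+1)%N, (weight f u - weight f v).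
(* The three extra steps mark the origin, cross the separator and test the mark at the end. *)
have -> : (bound.+1 * pair_length (u, v) + 3 =
   1 + (bound.+1 * size u + (1 + (bound.+1 * size v + 1))))%N.
  by rewrite /pair_length/= mulnDr; lia.
apply: reaches_trans (reaches1 _) _; rewrite start.
apply: (reaches_trans reach1); rewrite add0n add0r -/w.
apply: reaches_trans (reaches1 _) _.
rewrite (@step_cfg _ _ _ _ (inl (ord0, up1, true)) MoveRight Stay)//; last first.
  rewrite /= (nth_map None)/=; last by rewrite size_cat size_map/=; lia.
  by rewrite nth_cat size_map ltnn subnn.
rewrite addr0.
have -> : (size u)%:Z + move_offset MoveRight =
    (size (rcons (map some u) None))%:Z.
  by rewrite size_rcons size_map /=; lia.
apply: (reaches_trans reach2).
rewrite size_rcons size_map addSnnS.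
have -> : cfg w (inr (Some (weight f u != weight f v)))
    (size u + (size v).+1)%N (weight f u - weight f v) =
    step (cfg w (inl (ord0, up2, true)) (size u + (size v).+1)%N
      (weight f u - weight f v)).
  rewrite (@step_cfg _ _ _ _ (inr (Some (weight f u != weight f v))) Stay
    Stay)//.
    by rewrite !addr0.
  rewrite /= nth_default; last by rewrite !size_map size_cat/= !size_map.
  by rewrite /mark subr_eq0; case: (weight f u == _).
exact: reaches1.
Qed.

Lemma iter_step_halted w b n h t :
  iter t step (cfg w (inr (Some b)) n h) = cfg w (inr (Some b)) n h.
Proof.
elim: t => //= t ->; case: b; first by [].
by rewrite (@step_cfg _ _ _ _ (inr (Some false)) Stay Stay)// !addr0.
Qed.

Lemma weight_machine_neq p : weight f p.1 != weight f p.2 ->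
  decides_within weight_machine (encode_pair p)
    (bound.+1 * pair_length p + 3) false.
Proof.
move=> neq_p; have [n [h [t tT tE]]] := reaches_verdict p.
rewrite /decides_within -(subnK tT) iterD -/step tE neq_p.
by rewrite iter_step_halted.
Qed.

Lemma weight_machine_sound p t b :
  decides_within weight_machine (encode_pair p) t b ->
  b = false /\ weight f p.1 != weight f p.2.
Proof.
have [n [h [u _ uE]]] := reaches_verdict p.
rewrite /decides_within -/step => tb.
(* A verdict survives further steps, so the decision at time [t] can be compared at time [u + t]
   with the final state reached at time [u]. *)
have : weight_verdict (conf_state
    (iter (u + t) step (tm_init weight_machine (encode_pair p)))) = Some b.
  rewrite iterD; elim: u {uE} => //= u IHu.
  by rewrite {1}/step /tm_step /= IHu.
by rewrite addnC iterD uE iter_step_halted /=; case: eqP => //= _ [].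
Qed.

End WeightMachine.

Theorem theoremC (R : realType) (G : groupType)
  (hfg : finitely_generated G)
  (hnc : ~ cyclic_group G)
  (hab : infinite_set (abelianization G)) :
  conjugacy_problem_generically_linear_time R G.
Proof.
move=> A pi gen_pi.
have [f [a fa] f_conj] := conjugate_weight gen_pi hab.
exists (weight_machine f); split.
  move=> p t b /weight_machine_sound[-> neq_p]; split=> // /f_conj.
  by move/eqP: neq_p.
exists [set p | weight f p.1 != weight f p.2]; split.
  exact: generic_weight_neq fa.
by eexists; exists 3%N => p neq_p; exists false; exact: weight_machine_neq.
Qed.
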